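(* Let $G$ be a graph belonging to the family $\mathcal{F}_1$. Then the singleton coalition graph ${\rm CG}(G,\Gamma_1)$ belongs to the family $\mathcal{H}_1$.
   Context: All graphs are finite and simple. A full vertex of $G=(V,E)$ is a vertex adjacent to all other vertices. A set $D\subseteq V$ is dominating if every vertex not in $D$ has a neighbor in $D$. Two disjoint sets $A,B\subseteq V$ form a coalition if neither $A$ nor $B$ is a dominating set but $A\cup B$ is. A coalition partition of $G$ is a partition $\mathcal{P}$ of $V$ such that every member of $\mathcal{P}$ is either a dominating set of cardinality 1, or is not dominating and forms a coalition with some other member of $\mathcal{P}$. The coalition graph ${\rm CG}(G,\mathcal{P})$ has vertex set $\mathcal{P}$, two members being adjacent iff they form a coalition. $\Gamma_1$ denotes the partition of $V$ into singletons; $G$ is a singleton-partition graph (SP-graph) if $\Gamma_1$ is a coalition partition of $G$, and then ${\rm CG}(G,\Gamma_1)$ is its singleton coalition graph (vertex $\{v\}$ identified with $v$). The family $\mathcal{F}_1$: $G$ has vertex set $\{x,y,w\}\cup P\cup Q$, where $x,y,w$ are distinct, $P,Q$ are disjoint sets disjoint from $\{x,y,w\}$, $|P\cup Q|\ge 1$, and if $Q\neq\emptyset$ then $|Q|\ge 2$. Edges: $N(x)=\{y\}$; $N(w)=P\cup Q$; each $p\in P$ is adjacent to all vertices of $(P\cup Q)\setminus\{p\}$; if $Q\ne\emptyset$, $y$ is adjacent to all vertices of $Q$, and edges (possibly none) are added between vertices of $Q$ so that $G[Q]$ has no full vertex; finally any number of edges between $y$ and vertices of $P$ may be added. (Every graph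 in $\mathcal{F}_1$ is an SP-graph.) The family $\mathcal{H}_1$: all bipartite graphs with parts $A_1=\{x_1,y_1\}$ and $B_1=P_1\cup\{w_1\}\cup Q_1$, where $|P_1\cup Q_1|\ge1$ and if $Q_1\neq\emptyset$ then $|Q_1|\ge 2$; $y_1$ is adjacent to every vertex of $B_1$, and $x_1$ is adjacent exactly to the vertices of $P_1\cup\{w_1\}$; there are no other edges. *)

(* Defs.v *)
From mathcomp Require Import all_boot.

Set Implicit Arguments.
Unset Strict Implicit.
Unset Printing Implicit Defensive.

Record sgraph := SGraph {
  vertex :> finType;
  adj : rel vertex;
  adj_sym : symmetric adj;
  adj_irr : irreflexive adj
}.

Definition nbhd (G : sgraph) (v : G) : {set G} := [set u | adj v u].

Definition full_vertex (G : sgraph) (v : G) : bool :=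
  [forall u : G, (u != v) ==> adj v u].

Section Induced.
Variables (G : sgraph) (S : {set G}).

Definition induced_adj : rel {v : G | v \in S} := fun u v => adj (val u) (val v).

Lemma induced_adj_sym : symmetric induced_adj.
Proof. by move=> u v; exact: adj_sym. Qed.

Lemma induced_adj_irr : irreflexive induced_adj.
Proof. by move=> u; exact: adj_irr. Qed.

Definition induced : sgraph := SGraph induced_adj_sym induced_adj_irr.
End Induced.

Definition dominating (G : sgraph) (D : {set G}) : bool :=
  [forall v : G, (v \notin D) ==> [exists u in D, adj v u]].

Definition coalition (G : sgraph) (A B : {set G}) : bool :=
  [&& [disjoint A & B], ~~ dominating A, ~~ dominating B & dominating (A :|: B)].

(* The coalition graph makes sense for any family of vertex sets, so it is
   defined without requiring the family to be a coalition partition. *)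
Section CoalitionGraph.
Variables (G : sgraph) (Ptn : {set {set G}}).

Definition cg_adj : rel {A : {set G} | A \in Ptn} :=
  fun A B => coalition (val A) (val B).

Lemma cg_adj_sym : symmetric cg_adj.
Proof.
move=> A B; rewrite /cg_adj /coalition disjoint_sym setUC.
by congr (_ && _); rewrite andbCA.
Qed.

Lemma cg_adj_irr : irreflexive cg_adj.
Proof.
move=> A; rewrite /cg_adj /coalition setUid.
by case: (dominating _); rewrite !andbF.
Qed.

Definition coalition_graph : sgraph := SGraph cg_adj_sym cg_adj_irr.
End CoalitionGraph.

Definition singleton_partition (G : sgraph) : {set {set G}} :=
  [set [set v] | v : G].

(* The conditions below leave only the pairs inside Q and the pairs between y
   and P undetermined; every other pair is a forced edge or a forced non-edge. *)
Definition family_F1 (G : sgraph) : Prop :=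
  exists (x y w : G) (P Q : {set G}),
    [/\ [/\ uniq [:: x; y; w],
            [disjoint P & Q],
            [disjoint P :|: Q & [set x; y; w]] &
            [set x; y; w] :|: (P :|: Q) = [set: G]],
        1 <= #|P :|: Q|,
        nbhd x = [set y] /\ nbhd w = P :|: Q,
        forall p, p \in P -> (P :|: Q) :\ p \subset nbhd p &
        Q != set0 ->
          [/\ 2 <= #|Q|,
              Q \subset nbhd y &
              ~ exists q : induced Q, full_vertex q]].

Definition bipartite (G : sgraph) (A B : {set G}) : Prop :=
  [/\ [disjoint A & B],
      A :|: B = [set: G] &
      forall u v : G, adj u v ->
        (u \in A /\ v \in B) \/ (u \in B /\ v \in A)].

Definition family_H1 (G : sgraph) : Prop :=
  exists (x1 y1 w1 : G) (P1 Q1 : {set G}),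
    let A1 := [set x1; y1] in
    let B1 := P1 :|: [set w1] :|: Q1 in
    [/\ [/\ x1 != y1, [disjoint P1 & Q1] & w1 \notin P1 :|: Q1],
        bipartite A1 B1,
        1 <= #|P1 :|: Q1|,
        Q1 != set0 -> 2 <= #|Q1| &
        B1 \subset nbhd y1 /\ nbhd x1 = P1 :|: [set w1]].

(* Main.v *)
(** Since [x] has [y] as its only neighbour, every dominating pair of vertices
    meets [{x, y}]; since neither [x] nor [y] is adjacent to [w], the pair
    [{x, y}] is not dominating, and no single vertex dominates both [x] and [w].
    Hence all coalitions join [{x, y}] to the other vertices.  The set [{x, q}]
    with [q] in [Q] fails because [q] is not full in [G[Q]], and all the
    remaining pairs are dominating. *)
Require Import Defs.
From mathcomp Require Import all_boot.

Lemma dominating1P (G : sgraph) (a : G) :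
  reflect (forall v, v = a \/ adj v a) (dominating [set a]).
Proof.
apply: (iffP forallP) => [dom v | dom v].
  have /implyP := dom v; rewrite inE; case: eqP => [|_] /=; first by left.
  by move=> /(_ isT) /existsP[u /andP[/set1P-> ?]]; right.
apply/implyP; rewrite inE => /eqP va.
by apply/existsP; exists a; rewrite set11 /=; case: (dom v).
Qed.

Lemma dominating2P (G : sgraph) (a b : G) :
  reflect (forall v, [\/ v = a, v = b, adj v a | adj v b])
          (dominating [set a; b]).
Proof.
apply: (iffP forallP) => [dom v | dom v].
  have [->|va] := eqVneq v a; first by constructor 1.
  have [->|vb] := eqVneq v b; first by constructor 2.
  have /implyP := dom v; rewrite !inE negb_or va vb => /(_ isT).
  case/existsP=> u /andP[/set2P[]-> vu]; first by constructor 3.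
  by constructor 4.
apply/implyP; rewrite !inE negb_or => /andP[/eqP va /eqP vb].
apply/existsP; case: (dom v) => // h; first by exists a; rewrite !inE eqxx.
by exists b; rewrite !inE eqxx orbT.
Qed.

(** Taken on the vertices of [G] themselves, which realizes the identification of [[set v]] with [v]
    and avoids the subtype of sets underlying [coalition_graph]. *)
Definition singleton_coalition {G : sgraph} : rel G :=
  fun u v => coalition [set u] [set v].

Lemma singleton_coalition_sym (G : sgraph) : symmetric (@singleton_coalition G).
Proof.
move=> u v; rewrite /singleton_coalition /coalition disjoint_sym setUC.
by congr (_ && _); rewrite andbCA.
Qed.

Lemma singleton_coalition_irr (G : sgraph) :
  irreflexive (@singleton_coalition G).
Proof.
by move=> u; rewrite /singleton_coalition /coalition disjoints1 set11.
Qed.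

Definition singleton_coalition_graph (G : sgraph) : sgraph :=
  SGraph (@singleton_coalition_sym G) (@singleton_coalition_irr G).

(** Used to carry the result from [G]-vertices to singletons. The images under [f] of the five data
    serve as the new data. *)
Lemma family_H1_iso {G H : sgraph} {f : G -> H} :
  bijective f -> (forall u v, adj (f u) (f v) = adj u v) ->
  family_H1 G -> family_H1 H.
Proof.
move=> bijf adjf [x [y [w [P [Q [[xy dPQ wPQ] [dAB cov bip] c1 c2 [By Nx]]]]]]].
have injf := bij_inj bijf; have [g fK gK] := bijf.
have eB : f @: P :|: [set f w] :|: f @: Q = f @: (P :|: [set w] :|: Q).
  by rewrite !imsetU imset_set1.
have eA : [set f x; f y] = f @: [set x; y] by rewrite imsetU !imset_set1.
exists (f x), (f y), (f w), (f @: P), (f @: Q); rewrite /= eB eA -imsetU.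
split.
- by split; rewrite ?(inj_eq injf) ?imset_disjoint ?mem_imset //;
     apply: in2W.
- split; first by rewrite imset_disjoint //; apply: in2W.
  (* Writing [u] as [f (g u)] turns membership in an image into membership in the source. *)
  + by rewrite -imsetU cov; apply/setP=> u; rewrite -[u]gK mem_imset ?inE.
  + by move=> u v; rewrite -[u]gK -[v]gK adjf !mem_imset //; apply: bip.
- by rewrite card_imset.
- by rewrite card_imset // imset_eq0.
split.
  apply/subsetP=> u; rewrite -[u]gK mem_imset // => /(subsetP By).
  by rewrite !inE adjf.
apply/setP=> u; rewrite -(imset_set1 f) -imsetU -Nx -[u]gK mem_imset //.
by rewrite !inE adjf.
Qed.

(** The isomorphism is [v |-> [set v]]. *)
Lemma singleton_coalition_graph_iso (G : sgraph) :
  exists2 f : singleton_coalition_graph G ->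
              coalition_graph (singleton_partition G),
    bijective f & forall u v, adj (f u) (f v) = adj u v.
Proof.
have inS (v : G) : [set v] \in singleton_partition G by apply: imset_f.
pose f (v : G) : {A : {set G} | A \in singleton_partition G} :=
  exist _ [set v] (inS v).
(* Preservation of adjacency holds by computation; only bijectivity remains, with an inverse
   obtained by choice. *)
exists f => //.
have ex (A : {A : {set G} | A \in singleton_partition G}) :
    exists v : G, f v == A.
  case: A => A memA; have /imsetP[v _ eA] := memA.
  by exists v; apply/eqP/val_inj.
exists (fun A => xchoose (ex A)) => [v|A]; last exact/eqP/(xchooseP (ex A)).
by have /eqP/(congr1 val)/set1_inj := xchooseP (ex (f v)).
Qed.

(** The data [x], [y], [w], [P], [Q] of [family_F1] serve unchanged as the data of [family_H1]. *)
Lemma family_H1_singleton_coalition_graph (G : sgraph) :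
  family_F1 G -> family_H1 (singleton_coalition_graph G).
Proof.
case=> x [y [w [P [Q [[uxyw dPQ dR cov] c1 [Nx Nw] NP NQ]]]]].
have /and3P[] := uxyw; rewrite !inE negb_or => /andP[xy xw] yw _.
(* The dominating vertex stands second, as in [dominating]. *)
have adjxE v : adj v x = (v == y) by rewrite adj_sym -in_set1 -Nx inE.
have adjwE v : adj v w = (v \in P :|: Q) by rewrite adj_sym -Nw inE.
have Rneq v : v \in P :|: Q -> [/\ v != x, v != y & v != w].
  move=> Rv; have := disjointFr dR Rv; rewrite !inE.
  by case: eqP; case: eqP; case: eqP.
have xR : x \notin P :|: Q by apply/negP=> /Rneq[]; rewrite eqxx.
have yR : y \notin P :|: Q by apply/negP=> /Rneq[]; rewrite eqxx.
have wR : w \notin P :|: Q by apply/negP=> /Rneq[]; rewrite eqxx.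
have casesV v : [\/ v = x, v = y, v = w | v \in P :|: Q].
  have: v \in [set: G] by [].
  rewrite -cov in_setU => /orP[|]; last by constructor 4.
  rewrite !inE => /orP[/orP[]|] /eqP->;
    by [constructor 1 | constructor 2 | constructor 3].
have adjP p v : p \in P -> v \in P :|: Q -> v = p \/ adj v p.
  move=> Pp Rv; have [->|vp] := eqVneq v p; first by left.
  right; rewrite adj_sym; have /subsetP/(_ v) := NP p Pp.
  by rewrite in_setD1 vp Rv inE => /(_ isT).
have adjQ q : q \in Q -> adj q y.
  move=> Qq; have [|_ /subsetP/(_ q Qq)] := NQ; last by rewrite inE adj_sym.
  by apply/set0Pn; exists q.
have not_fullQ q : q \in Q -> exists2 r, r \in Q & r != q /\ ~~ adj r q.
  move=> Qq; have [|_ _ nofull] := NQ; first by apply/set0Pn; exists q.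
  have /forallPn[[r Qr]] : ~~ full_vertex (exist _ q Qq : induced Q).
    by apply/negP=> full_q; apply: nofull; exists (exist _ q Qq).
  rewrite negb_imply => /andP[rq nadj]; exists r => //.
  (* Inequality and adjacency in [induced Q] compute to those of [G]. *)
  by split; [exact: rq | rewrite adj_sym; exact: nadj].
have neqw v : v \in [set x; y] -> ((w == v) = false) * (adj w v = false).
  rewrite !inE adj_sym adjwE => /orP[] /eqP->.
    by rewrite (negbTE xR) eq_sym (negbTE xw).
  by rewrite (negbTE yR) eq_sym (negbTE yw).
(* The closed neighbourhood of [x] is [{x, y}]. *)
have domx v : x = v \/ adj x v -> v \in [set x; y].
  by rewrite !inE adj_sym adjxE => -[->|->]; rewrite ?eqxx ?orbT.
have nodom (v : G) : ~~ dominating [set v].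
  apply/negP=> /dominating1P dom; have /neqw eqs := domx v (dom x).
  by case: (dom w) => [/eqP|]; rewrite eqs.
(* Disjointness costs nothing: for [u = v] the union is a singleton, hence not dominating. *)
have coalE (u v : G) : singleton_coalition u v = dominating [set u; v].
  rewrite /singleton_coalition /coalition !nodom /= disjoints1 inE.
  by case: eqP => //= ->; rewrite setUid (negbTE (nodom v)).
(* At least one of [u], [v] lies in [{x, y}] to dominate [x], and not both, or [w] is missed. The
   exclusive or later yields bipartiteness. *)
have dom2xy (u v : G) : dominating [set u; v] ->
  (u \in [set x; y]) (+) (v \in [set x; y]).
  move=> /dominating2P dom.
  have /orP : (u \in [set x; y]) || (v \in [set x; y]).
    case: (dom x) => h; apply/orP; [left | right | left | right]; apply: domx;
      by [left | right].
  case: (boolP (u \in _)) => [/neqw uw | _];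
    case: (boolP (v \in _)) => [/neqw vw | _] //=.
    by case: (dom w) => [/eqP|/eqP||]; rewrite ?uw ?vw.
  by case.
(* Here [y] takes care of [x] and [Q], while [b] takes care of [w] and of [P], whose vertices are
   adjacent to everything else in [P :|: Q]. *)
have domy b : b \in P :|: Q -> dominating [set y; b].
  move=> Rb; apply/dominating2P=> v; have [->|->|->|Rv] := casesV v.
  - by constructor 3; rewrite adj_sym adjxE eqxx.
  - by constructor 1.
  - by constructor 4; rewrite adj_sym adjwE.
  have [Qv|nQv] := boolP (v \in Q); first by constructor 3; apply: adjQ.
  have Pv : v \in P by move: Rv; rewrite inE (negbTE nQv) orbF.
  have [->|bv] := adjP v b Pv Rb; first by constructor 2.
  by constructor 4; rewrite adj_sym.
(* The edge [xy] lets [a] cover [{x, y}]; [w] covers the rest. *)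
have domw a : a \in [set x; y] -> dominating [set a; w].
  move=> a_xy; apply/dominating2P=> v; have [->|->|->|Rv] := casesV v.
  - move: a_xy; rewrite !inE => /orP[] /eqP->; first by constructor 1.
    by constructor 3; rewrite adj_sym adjxE.
  - move: a_xy; rewrite !inE => /orP[] /eqP->; last by constructor 1.
    by constructor 3; rewrite adjxE.
  - by constructor 2.
  by constructor 4; rewrite adjwE.
have domp p : p \in P -> dominating [set x; p].
  move=> Pp; have Rp : p \in P :|: Q by rewrite inE Pp.
  apply/dominating2P=> v; have [->|->|->|Rv] := casesV v.
  - by constructor 1.
  - by constructor 3; rewrite adjxE.
  - by constructor 4; rewrite adj_sym adjwE.
  by have [->|vp] := adjP p v Pp Rv; [constructor 2 | constructor 4].
(* A vertex [r] of [Q] missed by [q] is missed by [x] too, since [x] reaches only [y]. *)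
have ndomq q : q \in Q -> ~~ dominating [set x; q].
  move=> /not_fullQ[r Qr [rq nadj]]; apply/negP=> /dominating2P/(_ r).
  have Rr : r \in P :|: Q by rewrite inE Qr orbT.
  have [rx ry _] := Rneq r Rr.
  by rewrite adjxE (negbTE ry) (negbTE nadj); case=> // /eqP;
    rewrite ?(negbTE rx) ?(negbTE rq).
have compl_xy v : (v \notin [set x; y]) = (v \in P :|: [set w] :|: Q).
  rewrite setUAC [RHS]in_setU.
  have [->|->|->|Rv] := casesV v.
  - by rewrite (negbTE xR) !inE eqxx (negbTE xw).
  - by rewrite (negbTE yR) !inE eqxx orbT (negbTE yw).
  - by rewrite !inE eqxx orbT !(eq_sym w) (negbTE xw) (negbTE yw).
  by have [/negbTE vx /negbTE vy _] := Rneq v Rv; rewrite Rv !inE vx vy.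
(* As a complement, the second part makes the bipartition conditions immediate from [dom2xy]. *)
have eBC : P :|: [set w] :|: Q = ~: [set x; y].
  by apply/setP=> v; rewrite -compl_xy in_setC.
exists x, y, w, P, Q; rewrite /= eBC; split=> //.
- split; [by rewrite -subsets_disjoint | exact: setUCr | move=> u v].
  rewrite /= coalE => /dom2xy; rewrite !in_setC.
  by case: (u \in _); case: (v \in _) => // _; [left|right].
- by case/NQ.
split.
  apply/subsetP=> b; rewrite -eBC setUAC in_setU => Bb.
  rewrite inE /= coalE; case/orP: Bb => [/domy //|].
  by move=> /set1P->; apply: domw; rewrite set22.
(* A partner [b] of [x] lies in the second part by [dom2xy] and outside [Q] by [ndomq]. *)
apply/setP=> b; rewrite [LHS]inE /= coalE; apply/idP/idP => [dom_xb|].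
  have := dom2xy _ _ dom_xb; rewrite set21 /= compl_xy in_setU.
  by case/orP=> // /ndomq; rewrite dom_xb.
by rewrite in_setU => /orP[/domp // | /set1P->]; apply: domw; rewrite set21.
Qed.

Theorem theorem4 (G : sgraph) (hG : family_F1 G) :
  family_H1 (coalition_graph (singleton_partition G)).
Proof.
have [f bijf adjf] := singleton_coalition_graph_iso G.
apply: (family_H1_iso bijf adjf).
exact: family_H1_singleton_coalition_graph hG.
Qed.
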